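(* Let $d\in\mathbb N^+$ and $\alpha,\lambda,\mu>0$. For the process $\mathcal N$ (defined in the context) let $\rho(0)=\lim_{t\to+\infty}p(0,t)$ and $\rho(k)=\lim_{t\to+\infty}P(k,t)$, $k\in\mathbb N^+$. If $\lambda<\mu$, then $$\rho(0)=\frac1d\;\frac{\left(1-\frac{\lambda}{\mu}\right)^{\frac{\alpha}{\lambda}}}{1-\left(1-\frac1d\right)\left(1-\frac{\lambda}{\mu}\right)^{\frac{\alpha}{\lambda}}},\qquad \rho(k)=\frac{\left(1-\frac{\lambda}{\mu}\right)^{\frac{\alpha}{\lambda}}}{1-\left(1-\frac1d\right)\left(1-\frac{\lambda}{\mu}\right)^{\frac{\alpha}{\lambda}}}\;\frac{\left(\frac{\alpha}{\lambda}\right)_k}{k!}\left(\frac{\lambda}{\mu}\right)^k,\quad k\in\mathbb N^+.$$ If $\lambda\ge\mu$, then $\rho(k)=0$ for all $k\in\mathbb N_0=\{0,1,2,\ldots\}$.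
   Context: Let $D=\{1,\ldots,d\}$. $\mathcal N=\{(N(t),J(t)),t\ge 0\}$ is the (nonexplosive) continuous-time Markov chain on $S=\{(0,0)\}\cup(\mathbb N^+\times D)$ whose only nonzero off-diagonal transition rates are, for $k\in\mathbb N^+$ and $j\in D$: from $(0,0)$ to $(1,j)$ at rate $\alpha$; from $(k,j)$ to $(k+1,j)$ at rate $\alpha+\lambda k$; from $(k,j)$ to $(k-1,j)$ at rate $\mu k$, where $(0,j)$ is identified with $(0,0)$ for every $j$. The initial state is $0:=(0,0)$. Put $p(0,t)=\mathbb P\{(N(t),J(t))=0\mid (N(0),J(0))=0\}$, $p(k,j,t)=\mathbb P\{(N(t),J(t))=(k,j)\mid (N(0),J(0))=0\}$, and $P(k,t)=\sum_{j=1}^d p(k,j,t)$ for $k\in\mathbb N^+$. $(a)_k=a(a+1)\cdots(a+k-1)$, $(a)_0=1$, is the Pochhammer symbol. *)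

(* Defs.v *)
From HB Require Import structures.
From mathcomp Require Import all_boot all_order all_algebra.
From mathcomp Require Import all_classical all_reals all_analysis.
Set Implicit Arguments.
Unset Strict Implicit.
Unset Printing Implicit Defensive.
Import Order.TTheory GRing.Theory Num.Theory.
Import numFieldNormedType.Exports.
Local Open Scope classical_set_scope.
Local Open Scope ring_scope.

Definition pochhammer (R : realType) (a : R) (k : nat) : R :=
  \prod_(0 <= i < k) (a + i%:R).

(* Elementary conditional probability P(A | B); only meaningful if P B > 0. *)
Definition cprob (R : realType) (disp : measure_display)
    (T : measurableType disp) (P : probability T R) (A B : set T) : R :=
  fine (P (A `&` B)) / fine (P B).

(* The diagonal values of [rate] are ignored: they are fixed by the requirement
   that each row of the Q-matrix sums to zero. *)
Definition qmatrix (R : realType) (S : choiceType) (rate : S -> S -> R)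
    (x y : S) : R :=
  if x == y then - fine (\esum_(z in [set z | z != x]) (rate x z)%:E)
  else rate x y.

(* Only times t >= 0 matter.  Nonexplosion is encoded by [tf_mass1]: no mass
   escapes from S in finite time.  [tf_rate] is P'(0+) = Q. *)
Record transition_function (R : realType) (S : choiceType)
    (rate : S -> S -> R) (p : R -> S -> S -> R) : Prop := TransitionFunction {
  tf_ge0 : forall t x y, 0 <= t -> 0 <= p t x y ;
  tf_mass1 : forall t x, 0 <= t -> \esum_(y in setT) (p t x y)%:E = 1%E ;
  tf_init : forall x y, p 0 x y = (x == y)%:R ;
  tf_chapman_kolmogorov : forall s t x y, 0 <= s -> 0 <= t ->
    (p (s + t) x y)%:E = \esum_(z in setT) (p s x z * p t z y)%:E ;
  tf_rate : forall x y,
    ((p h x y - (x == y)%:R) / h) @[h --> 0^'+] --> qmatrix rate x y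
}.

(* A history h is a list of pairs (time, state). *)
Definition followed (R : realType) (T : Type) (S : choiceType)
    (X : R -> T -> S) (h : seq (R * S)) : set T :=
  [set w | forall e, e \in h -> X e.1 w = e.2].

(* Time-homogeneous nonexplosive chain.  The listed times of a history may come
   in any order, so these are all the elementary conditionings on the past up to
   s.  No regularity of the sample paths is required. *)
Definition ctmc (R : realType) (disp : measure_display)
    (T : measurableType disp) (P : probability T R) (S : choiceType)
    (rate : S -> S -> R) (X : R -> T -> S) : Prop :=
  (forall t x, 0 <= t -> measurable [set w | X t w = x]) /\
  exists2 p : R -> S -> S -> R, transition_function rate p &
    forall (s t : R) (h : seq (R * S)) (x y : S),
      0 <= s -> 0 <= t -> (forall e, e \in h -> 0 <= e.1 <= s) ->
      let past := [set w | X s w = x] `&` followed X h in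
      (0 < P past)%E -> cprob P [set w | X (s + t) w = y] past = p t x y.

(* {(0, 0)} together with the pairs (k, j) with k >= 1 and 1 <= j <= d. *)
Definition in_state (d : nat) (x : nat * nat) : bool :=
  (x == (0, 0)%N) || ((0 < x.1)%N && (1 <= x.2 <= d)%N).

Definition state (d : nat) := {x : nat * nat | in_state d x}.

Definition origin (d : nat) : state d :=
  exist (fun x => in_state d x) (0, 0)%N isT.

(* Rates from (k, i) to (l, j), both in the state space.  The last test uses
   that (0, j) is identified with (0, 0) for every j. *)
Definition star_rate (R : realType) (alpha lambda mu : R) (d : nat)
    (x y : state d) : R :=
  let: (k, i) := val x in
  let: (l, j) := val y in
  if k == 0%N then (if l == 1%N then alpha else 0)
  else if (l == k.+1) && (j == i) then alpha + lambda * k%:R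
  else if (l == k.-1) && ((l == 0%N) || (j == i)) then mu * k%:R
  else 0.

Section Probabilities.
Context (R : realType) (disp : measure_display) (T : measurableType disp).
Context (P : probability T R) (d : nat) (X : R -> T -> state d).

Definition p0 (t : R) : R :=
  cprob P [set w | X t w = origin d] [set w | X 0 w = origin d].

Definition pkj (k j : nat) (t : R) : R :=
  cprob P [set w | val (X t w) = (k, j)] [set w | X 0 w = origin d].

Definition Pk (k : nat) (t : R) : R := \sum_(1 <= j < d.+1) pkj k j t.

End Probabilities.

(* Main.v *)
(** Proof idea.  The rates satisfy detailed balance for the weights
    [m (k, j) = (alpha / lambda)_k / k! * (lambda / mu) ^ k].  The backward
    equation holds for [p], while [m y * p t y x / m x] satisfies it with an
    inequality; since the rates grow linearly, a discrete maximum principle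
    compares the two and makes the semigroup reversible.  Then
    [p (s + t) x y / m y] is the inner product of [p s x] and [p t y] in
    [l^2 (1 / m)], so its diagonal quadratic forms are bounded and midpoint convex
    in time, hence nonincreasing, and all the limits exist.  As a function of the
    starting point a limit is harmonic, which on the star determines it up to a
    constant: if [lambda < mu] it does not depend on the starting point, and its
    value follows from the finite total mass of [m], given by the binomial series;
    if [mu <= lambda] it is nondecreasing along some branch, which carries
    infinite [m]-mass, so that it vanishes at the origin. *)

Require Import Defs.
From HB Require Import structures.
From mathcomp Require Import all_boot all_order all_algebra.
From mathcomp Require Import all_classical all_reals all_analysis.
From mathcomp Require Import ring lra.
Set Implicit Arguments.
Unset Strict Implicit.
Unset Printing Implicit Defensive.
Import Order.TTheory GRing.Theory Num.Theory.
Import numFieldNormedType.Exports.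
Local Open Scope classical_set_scope.
Local Open Scope ring_scope.

(** * Sums over a discrete set *)

Lemma esum_seq_set (R : realType) (S : choiceType) (s : seq S) (f : S -> R) :
  uniq s -> (forall x, 0 <= f x) ->
  \esum_(x in [set` s]) (f x)%:E = (\sum_(x <- s) f x)%:E.
Proof.
move=> us f0; rewrite esum_fset.
- by rewrite -sumEFin -fsbig_seq.
- exact: finite_seq.
- by move=> x _; rewrite lee_fin.
Qed.

Lemma esum_split_seq (R : realType) (S : choiceType) (s : seq S) (f : S -> R) :
  uniq s -> (forall x, 0 <= f x) ->
  \esum_(x in setT) (f x)%:E =
  ((\sum_(x <- s) f x)%:E + \esum_(x in ~` [set` s]) (f x)%:E)%E.
Proof.
move=> us f0; rewrite (esumID [set` s]); last by move=> x _; rewrite lee_fin.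
by rewrite !setTI esum_seq_set.
Qed.

Lemma le_seq_esum (R : realType) (S : choiceType) (s : seq S) (f : S -> R) :
  uniq s -> (forall x, 0 <= f x) ->
  ((\sum_(x <- s) f x)%:E <= \esum_(x in setT) (f x)%:E)%E.
Proof.
move=> us f0; rewrite (esum_split_seq us)// leeDl// esum_ge0// => x _.
by rewrite lee_fin.
Qed.

Lemma esum_le_seq (R : realType) (S : choiceType) (f : S -> R) (M : R) :
  (forall x, 0 <= f x) ->
  (forall s, uniq s -> \sum_(x <- s) f x <= M) ->
  (\esum_(x in setT) (f x)%:E <= M%:E)%E.
Proof.
move=> f0 fM; apply: ge_ereal_sup => _ [A [finA _] <-].
rewrite fsbig_finite// sumEFin lee_fin; apply: fM.
exact: finmap.fset_uniq.
Qed.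

Lemma near_all_seq (T : Type) (F : set_system T) (S : eqType) (s : seq S)
    (Q : S -> T -> Prop) : Filter F ->
  (forall x, x \in s -> \forall h \near F, Q x h) ->
  \forall h \near F, forall x, x \in s -> Q x h.
Proof.
move=> FF; elim: s => [|a s IH] H; first by near=> h.
have Ha := H a (mem_head _ _).
have Hs : \forall h \near F, forall x, x \in s -> Q x h.
  by apply: IH => x xs; apply: H; rewrite inE xs orbT.
near=> h => x; rewrite inE => /orP[/eqP ->|]; first by near: h.
by move: x; near: h.
Unshelve. all: by end_near. Qed.

(** * Transition functions and reversibility *)

Section transition.
Context (R : realType) (S : choiceType) (rate : S -> S -> R).
Context (p : R -> S -> S -> R) (tf : transition_function rate p).

Lemma tf_sum_le1 t x s : 0 <= t -> uniq s -> \sum_(z <- s) p t x z <= 1.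
Proof.
move=> t0 us; rewrite -lee_fin -(tf_mass1 tf x t0) le_seq_esum// => z.
exact: (tf_ge0 tf).
Qed.

Lemma tf_le1 t x y : 0 <= t -> p t x y <= 1.
Proof.
by move=> t0; have := tf_sum_le1 x t0 (isT : uniq [:: y]); rewrite big_seq1.
Qed.

Lemma chapman_ge s t x y r : 0 <= s -> 0 <= t -> uniq r ->
  \sum_(z <- r) p s x z * p t z y <= p (s + t) x y.
Proof.
move=> s0 t0 ur; rewrite -lee_fin (tf_chapman_kolmogorov tf)//.
by apply: le_seq_esum => // z; rewrite mulr_ge0// (tf_ge0 tf).
Qed.

(** Outside [r] the row [p s x] has mass [1 - \sum_(z <- r) p s x z], and each factor [p t z y]
    there is at most 1. *)
Lemma chapman_le s t x y r : 0 <= s -> 0 <= t -> uniq r ->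
  p (s + t) x y <=
  \sum_(z <- r) p s x z * p t z y + (1 - \sum_(z <- r) p s x z).
Proof.
move=> s0 t0 ur; rewrite -lee_fin (tf_chapman_kolmogorov tf)//.
have pp z : 0 <= p s x z by exact: (tf_ge0 tf).
have pq z : 0 <= p s x z * p t z y by rewrite mulr_ge0// (tf_ge0 tf).
rewrite (esum_split_seq ur)// EFinD leeD2l//.
apply: (@le_trans _ _ (\esum_(z in ~` [set` r]) (p s x z)%:E)%E).
  by apply: le_esum => z _; rewrite lee_fin ler_piMr// tf_le1.
have := tf_mass1 tf x s0; rewrite (esum_split_seq ur)//.
by rewrite EFinB => <-; rewrite addeAC subee// add0e.
Qed.

End transition.

(** * Backward equation for rates with finitely many neighbours *)

Section local_rates.
Context (R : realType) (S : choiceType) (rate : S -> S -> R).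
Context (p : R -> S -> S -> R) (tf : transition_function rate p).
Context (nbr : S -> seq S) (nbr_uniq : forall x, uniq (nbr x)).
Context (nbr_irr : forall x, x \notin nbr x).
Context (rate_ge0 : forall x z, 0 <= rate x z).
Context (rate_nbr : forall x z, z != x -> z \notin nbr x -> rate x z = 0).

(** The Q-matrix acting on functions; since its rows sum to zero, the diagonal term is absorbed into
    the differences, and constants are killed. *)
Definition generator (f : S -> R) (x : S) : R :=
  \sum_(z <- nbr x) rate x z * (f z - f x).

Lemma generator_cst c x : generator (fun=> c) x = 0.
Proof. by rewrite /generator big1// => z _; rewrite subrr mulr0. Qed.

Lemma qmatrix_diag x : qmatrix rate x x = - \sum_(z <- nbr x) rate x z.
Proof.
rewrite /qmatrix eqxx; congr (- _).
have -> : (\esum_(z in [set z | z != x]) (rate x z)%:E =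
           \esum_(z in [set` nbr x]) (rate x z)%:E)%E.
  rewrite [LHS]esum_mkcond [RHS]esum_mkcond; apply: eq_esum => z _.
  have [->|zx] := eqVneq z x.
    by rewrite !memNset//=; [exact/negP|rewrite eqxx].
  rewrite [in LHS]mem_set//; have [zn|zn] := boolP (z \in nbr x).
    by rewrite mem_set.
  by rewrite memNset/= ?rate_nbr//; exact/negP.
by rewrite esum_seq_set.
Qed.

Lemma qmatrix_off x z : x != z -> qmatrix rate x z = rate x z.
Proof. by rewrite /qmatrix => /negbTE ->. Qed.

Lemma generatorE f x :
  generator f x = \sum_(z <- x :: nbr x) qmatrix rate x z * f z.
Proof.
rewrite big_cons qmatrix_diag mulNr mulr_suml addrC -sumrB.
rewrite /generator big_seq [RHS]big_seq; apply: eq_bigr => z zx.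
rewrite mulrBr qmatrix_off//.
by apply: contraTneq zx => <-; exact: nbr_irr.
Qed.

Lemma uniq_cons_nbr x : uniq (x :: nbr x).
Proof. by rewrite /= nbr_irr nbr_uniq. Qed.

Lemma tf_rate_near x y e : 0 < e ->
  \forall h \near 0^'+, `|p h x y - (x == y)%:R - h * qmatrix rate x y| <= h * e.
Proof.
move=> e0; have /cvgrPdist_le /(_ e e0) H := @tf_rate _ _ _ _ tf x y.
near=> h.
have h0 : 0 < h by near: h; exact: nbhs_right_gt.
have : `|qmatrix rate x y - (p h x y - (x == y)%:R) / h| <= e by near: h.
rewrite -(ler_pM2l h0) -{1}(gtr0_norm h0) -normrM mulrBr mulrCA divff ?gt_eqF//.
by rewrite mulr1 distrC.
Unshelve. all: by end_near. Qed.

(* The part of [p h x] outside [x :: nbr x] has mass [o(h)], because the row of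
   the Q-matrix sums to zero; hence the error does not depend on [t] or [y]. *)
Lemma backward_step x e : 0 < e ->
  \forall h \near 0^'+, forall t y, 0 <= t ->
  `|p (h + t) x y - p t x y - h * generator (p t ^~ y) x| <= h * e.
Proof.
move=> e0; set F := x :: nbr x.
pose n := (size F)%:R : R.
have n0 : 0 < n by rewrite ltr0n.
(* The errors of the [n] states in [F] then add up to at most [h * (e / 2)]. This is spent twice: on
   the sum over [F] and on the mass of [p h x] outside [F]. *)
have en : 0 < e / (2 * n) by rewrite divr_gt0// mulr_gt0.
have H : \forall h \near 0^'+, forall z, z \in F ->
    `|p h x z - (x == z)%:R - h * qmatrix rate x z| <= h * (e / (2 * n)).
  by apply: near_all_seq => z _; exact: tf_rate_near.
near=> h; move=> t y t0.
have h0 : 0 < h by near: h; exact: nbhs_right_gt.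
have H1 : forall z, z \in F ->
    `|p h x z - (x == z)%:R - h * qmatrix rate x z| <= h * (e / (2 * n)).
  by near: h.
pose r z := p h x z - (x == z)%:R - h * qmatrix rate x z.
have pE z : p h x z = (x == z)%:R + h * qmatrix rate x z + r z.
  by rewrite /r; ring.
have sumF g : \sum_(z <- F) p h x z * g z =
    g x + h * generator g x + \sum_(z <- F) r z * g z.
  rewrite generatorE mulr_sumr.
  under eq_bigr do rewrite pE mulrDl mulrDl -mulrA.
  rewrite 2!big_split /=; congr (_ + _ + _).
  rewrite big_cons eqxx mul1r big_seq big1 ?addr0// => z zx.
  case: eqVneq => [xz|]; last by rewrite mul0r.
  by rewrite -xz (negbTE (nbr_irr x)) in zx.
have rb g : (forall z, 0 <= g z <= 1) ->
    `|\sum_(z <- F) r z * g z| <= h * (e / 2).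
  move=> g01; apply: le_trans (ler_norm_sum _ _ _) _.
  apply: (@le_trans _ _ (\sum_(z <- F) h * (e / (2 * n)))).
    rewrite big_seq [leRHS]big_seq; apply: ler_sum => z zF.
    rewrite normrM; have /andP[g0 g1] := g01 z.
    apply: le_trans (H1 z zF); rewrite -/(r z) ler_piMr//.
    by rewrite ger0_norm.
  rewrite big_const_seq count_predT iter_addr_0 -mulr_natr -/n.
  rewrite le_eqVlt; apply/orP; left; apply/eqP; field.
  by rewrite gt_eqF.
have lo := chapman_ge tf x y (ltW h0) t0 (uniq_cons_nbr x).
have up := chapman_le tf x y (ltW h0) t0 (uniq_cons_nbr x).
rewrite -/F in lo up.
have := sumF (fun=> 1); rewrite generator_cst mulr0 addr0.
under [LHS]eq_bigr do rewrite mulr1.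
move=> s1.
have := rb (fun=> 1) (fun=> ltac:(by rewrite ler01 lexx)).
have := rb (p t ^~ y) (fun z => ltac:(by rewrite (tf_ge0 tf)// (tf_le1 tf))).
rewrite s1 sumF in up; rewrite sumF in lo.
move: lo up; set a := \sum_(z <- F) _; set b := \sum_(z <- F) _.
move=> lo up; rewrite !ler_norml => /andP[a1 a2] /andP[b1 b2].
by apply/andP; split; lra.
Unshelve. all: by end_near. Qed.

(** For such [h], one Euler step is a combination of values of the function with nonnegative
    coefficients, hence monotone. *)
Lemma generator_le (f g : S -> R) x (h : R) : 0 <= h ->
  h * \sum_(z <- nbr x) rate x z <= 1 ->
  (forall z, f z <= g z) ->
  f x + h * generator f x <= g x + h * generator g x.
Proof.
move=> h0 hq fg.
have E u : u x + h * generator u x =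
    (1 - h * \sum_(z <- nbr x) rate x z) * u x +
    h * \sum_(z <- nbr x) rate x z * u z.
  rewrite /generator (eq_bigr (fun z => rate x z * u z - rate x z * u x)).
    by rewrite sumrB -mulr_suml; ring.
  by move=> z _; rewrite mulrBr.
rewrite !E lerD// ?ler_wpM2l// ?subr_ge0//.
by apply: ler_sum => z _; rewrite ler_wpM2l.
Qed.

(** * Detailed balance and the forward inequality *)

Section detailed_balance.
Context (m : S -> R) (m_gt0 : forall x, 0 < m x).
Context (balance : forall x z, m x * rate x z = m z * rate z x).

Lemma qmatrix_balance x z : m x * qmatrix rate x z = m z * qmatrix rate z x.
Proof.
have [->//|xz] := eqVneq x z.
by rewrite !qmatrix_off// eq_sym.
Qed.

(** Arrivals at [x] from outside [x :: nbr x] are nonnegative and are dropped, so only an inequality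
    results. Detailed balance turns the column of the Q-matrix into the generator acting on
    [p t y z / m z]; as [p <= 1], the error is uniform in [t] and [y]. *)
Lemma forward_step x e : 0 < e ->
  \forall h \near 0^'+, forall t y, 0 <= t ->
  p t y x / m x + h * generator (fun z => p t y z / m z) x - h * e <=
  p (t + h) y x / m x.
Proof.
move=> e0; set F := x :: nbr x.
pose n := (size F)%:R : R.
have n0 : 0 < n by rewrite ltr0n.
(* The [n] errors add up to [h * (e * m x)], which becomes [h * e] after division by [m x]. *)
have en : 0 < e * m x / n by rewrite divr_gt0// mulr_gt0.
have H : \forall h \near 0^'+, forall z, z \in F ->
    `|p h z x - (z == x)%:R - h * qmatrix rate z x| <= h * (e * m x / n).
  by apply: near_all_seq => z _; exact: tf_rate_near.
near=> h; move=> t y t0.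
have h0 : 0 < h by near: h; exact: nbhs_right_gt.
have H1 : forall z, z \in F ->
    `|p h z x - (z == x)%:R - h * qmatrix rate z x| <= h * (e * m x / n).
  by near: h.
have mx0 : m x != 0 by rewrite gt_eqF.
rewrite ler_pdivlMr//.
apply: le_trans (chapman_ge tf y x t0 (ltW h0) (uniq_cons_nbr x)).
have E1 : \sum_(z <- F) p t y z * (z == x)%:R = p t y x.
  rewrite big_cons eqxx mulr1 big_seq big1 ?addr0// => z zx.
  case: eqVneq => [xz|]; last by rewrite mulr0.
  by rewrite xz (negbTE (nbr_irr x)) in zx.
have E2 : \sum_(z <- F) p t y z * (h * qmatrix rate z x) =
    h * (m x * generator (fun z => p t y z / m z) x).
  rewrite generatorE !mulr_sumr; apply: eq_bigr => z _.
  rewrite mulrCA; congr (_ * _); rewrite mulrA qmatrix_balance.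
  by field; rewrite gt_eqF.
have E3 : \sum_(z <- F) h * (e * m x / n) = h * (e * m x).
  rewrite big_const_seq count_predT iter_addr_0 -mulr_natr -/n.
  by field; rewrite gt_eqF.
have -> : (p t y x / m x + h * generator (fun z => p t y z / m z) x - h * e) * m x
    = \sum_(z <- F) (p t y z * ((z == x)%:R + h * qmatrix rate z x)
                     - h * (e * m x / n)).
  rewrite sumrB E3; under eq_bigr do rewrite mulrDr.
  by rewrite big_split /= E1 E2; field.
rewrite big_seq [leRHS]big_seq; apply: ler_sum => z zF.
have := H1 z zF; rewrite ler_norml => /andP[lo _].
have p0 : 0 <= p t y z by exact: (tf_ge0 tf).
have p1 : p t y z <= 1 by exact: (tf_le1 tf).
have c0 : 0 <= h * (e * m x / n) by rewrite mulr_ge0 ?ltW.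
nra.
Unshelve. all: by end_near. Qed.

(** * Reversibility by comparison with a Lyapunov function *)

Section nonexplosion.
Context (V : S -> R) (K : R) (V_ge1 : forall x, 1 <= V x) (K_ge0 : 0 <= K).
Context (V_finite : forall c, exists s : seq S, forall x, V x <= c -> x \in s).
Context (V_lyapunov : forall x, generator V x <= K * V x).

(* Discrete maximum principle: [p t x y] solves the backward equation and
   [m y * p t y x / m x] is a supersolution.  Along an Euler scheme, their
   difference stays below the barrier [e * (1 + (K + 1) * h) ^+ k * V x], which
   is automatic outside a finite set since the difference is at most 1. *)
Lemma reversible_le_barrier t x y e : 0 <= t -> 0 < e ->
  p t x y / m y <= p t y x / m x + e * expR ((K + 1) * t) * V x.
Proof.
(* Time 0 is treated apart because the Euler step [t / n] has to be positive. *)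
rewrite le_eqVlt => /predU1P[<-|t0] e0.
  have V0 z : 0 <= V z by apply: le_trans (V_ge1 z).
  rewrite !(tf_init tf) mulr0 expR0 mulr1 [y == x]eq_sym.
  have [->|_] := eqVneq x y; first by rewrite lerDl mulr_ge0// ?ltW.
  by rewrite !mul0r add0r mulr_ge0// ?ltW.
have V0 z : 0 < V z by apply: lt_le_trans (V_ge1 z).
(* Outside [s], [e * V] exceeds [(m y)^-1], which bounds [p t z y / m y]; the infinitesimal
   estimates are therefore needed only at the finitely many points of [s]. *)
have [s sP] := V_finite ((m y)^-1 / e).
(* After division by [m y] this error is [h * (e / 2)]. Together with the forward error it makes
   [h * e], which the summand 1 in [K + 1] absorbs because [V >= 1]. *)
have N1 : \forall h \near 0^'+, forall z, z \in s -> forall t u, 0 <= t ->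
  `|p (h + t) z u - p t z u - h * generator (p t ^~ u) z| <= h * (e / 2 * m y).
  apply: near_all_seq => z _; apply: backward_step.
  by rewrite mulr_gt0// divr_gt0.
have N2 : \forall h \near 0^'+, forall z, z \in s -> forall t y, 0 <= t ->
  p t y z / m z + h * generator (fun z => p t y z / m z) z - h * (e / 2) <=
  p (t + h) y z / m z.
  by apply: near_all_seq => z _; apply: forward_step; rewrite divr_gt0.
have N3 : \forall h \near 0^'+, forall z, z \in s ->
  h * \sum_(w <- nbr z) rate z w <= 1.
  apply: near_all_seq => z _.
  have c0 : 0 < 1 + \sum_(w <- nbr z) rate z w.
    by rewrite ltr_wpDr// sumr_ge0.
  have d0 : 0 < 1 / (1 + \sum_(w <- nbr z) rate z w) by rewrite divr_gt0.
  near=> h; have h0 : 0 < h by near: h; exact: nbhs_right_gt.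
  apply: (@le_trans _ _ (h * (1 + \sum_(w <- nbr z) rate z w))).
    by rewrite ler_wpM2l ?ltW// ltrDr.
  rewrite -ler_pdivlMr//; near: h; exact: nbhs_right_le.
have [h [[h0 [n tE]] [{}N1 [{}N2 {}N3]]]] : exists h : R,
  (0 < h /\ exists n, t = n%:R * h) /\
  (forall z, z \in s -> forall t u, 0 <= t ->
  `|p (h + t) z u - p t z u - h * generator (p t ^~ u) z| <= h * (e / 2 * m y)) /\
  (forall z, z \in s -> forall t y, 0 <= t ->
  p t y z / m z + h * generator (fun z => p t y z / m z) z - h * (e / 2) <=
  p (t + h) y z / m z) /\
  (forall z, z \in s -> h * \sum_(w <- nbr z) rate z w <= 1).
  have /filterI /(_ (filterI N2 N3)) := N1.
  move=> [r /= r0 H].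
  (* With this [n] the step [t / n] is below [r], and the grid reaches [t] exactly. *)
  pose n := (Num.trunc (t / r)).+1.
  have nr : t / r < n%:R by exact: truncnS_gt.
  exists (t / n%:R); split; first split.
  - by rewrite divr_gt0.
  - by exists n; rewrite mulrCA divff ?mulr1// pnatr_eq0.
  - have [||? []] := H (t / n%:R); last by [].
    + rewrite /ball /= sub0r normrN gtr0_norm ?divr_gt0//.
      by rewrite ltr_pdivrMr// mulrC -ltr_pdivrMr.
    + by rewrite divr_gt0.
have Kh : 0 <= (K + 1) * h by rewrite mulr_ge0 ?addr_ge0// ltW.
suff step k : forall z, p (k%:R * h) z y / m y - p (k%:R * h) y z / m z <=
    e * (1 + (K + 1) * h) ^+ k * V z.
  rewrite -lerBlDl tE; apply: le_trans (step n x) _.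
  apply: ler_wpM2r; first exact: ltW.
  apply: ler_wpM2l; first exact: ltW.
  rewrite mulrCA expRM_natl; apply: lerXn2r; rewrite ?nnegrE ?expR_ge0//.
    by rewrite addr_ge0.
  exact: expR_ge1Dx.
have b1 : 1 <= 1 + (K + 1) * h by rewrite lerDl.
elim: k => [z|k IH z].
  rewrite mul0r !(tf_init tf) [y == z]eq_sym expr0 mulr1.
  have eV : 0 <= e * V z by rewrite mulr_ge0// ltW.
  have [zy|_] := eqVneq z y; last by rewrite !mul0r subrr.
  by rewrite -zy subrr.
have ek : e <= e * (1 + (K + 1) * h) ^+ k.+1.
  by apply: ler_peMr; [exact: ltW|exact: exprn_ege1].
have k0 : 0 <= k%:R * h by rewrite mulr_ge0// ltW.
have k1 : 0 <= k.+1%:R * h by rewrite mulr_ge0// ltW.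
have [zs|zs] := boolP (z \in s); last first.
  have vz : (m y)^-1 <= e * V z.
    rewrite mulrC -ler_pdivrMr// leNgt; apply: contra zs => /ltW.
    exact: sP.
  have le1 : p (k.+1%:R * h) z y / m y <= (m y)^-1.
    by rewrite ler_piMl ?invr_ge0 ?(tf_le1 tf)// ltW.
  have ge0 : 0 <= p (k.+1%:R * h) y z / m z.
    by rewrite divr_ge0 ?(tf_ge0 tf)// ltW.
  have eV : e * V z <= e * (1 + (K + 1) * h) ^+ k.+1 * V z.
    by apply: ler_wpM2r => //; exact: ltW.
  lra.
have {}N1 := N1 z zs _ y k0.
have {}N2 := N2 z zs _ y k0.
have {}N3 := N3 z zs.
have kE : k.+1%:R * h = k%:R * h + h by rewrite -natr1 mulrDl mul1r.
rewrite kE; rewrite (addrC h) in N1.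
set B := e * (1 + (K + 1) * h) ^+ k in IH *.
have BE : e * (1 + (K + 1) * h) ^+ k.+1 = B * (1 + (K + 1) * h).
  by rewrite exprSr mulrA.
have eB : e <= B by apply: ler_peMr; [exact: ltW|exact: exprn_ege1].
rewrite BE.
set q := p (k%:R * h) in N1 N2 IH *; set q' := p (k%:R * h + h) in N1 N2 *.
pose f w := q w y / m y; pose g w := q y w / m w.
have /(generator_le (ltW h0) N3) G :
  forall w, f w - g w <= B * V w by [].
have GB : generator (fun w => f w - g w) z = generator f z - generator g z.
  by rewrite /generator -sumrB; apply: eq_bigr => w _; ring.
have Gf : generator f z = generator (q ^~ y) z / m y.
  by rewrite /generator mulr_suml; apply: eq_bigr => w _; rewrite /f; ring.
have GV : generator (fun w => B * V w) z = B * generator V z.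
  by rewrite /generator mulr_sumr; apply: eq_bigr => w _; ring.
rewrite GB GV in G.
have {}N1 : q' z y / m y <= f z + h * generator f z + h * (e / 2).
  rewrite ler_pdivrMr//; move: N1; rewrite Gf ler_norml => /andP[_ N1].
  have -> : (f z + h * (generator (q^~ y) z / m y) + h * (e / 2)) * m y =
    q z y + h * generator (q ^~ y) z + h * (e / 2 * m y).
    by rewrite /f; field; rewrite gt_eqF.
  by lra.
have B0 : 0 < B by exact: lt_le_trans eB.
have L : h * (B * generator V z) <= h * (B * (K * V z)).
  by apply: ler_wpM2l; [exact: ltW|apply: ler_wpM2l => //; exact: ltW].
have E : h * e <= h * (B * V z).
  apply: ler_wpM2l; [exact: ltW|apply: le_trans eB _].
  by apply: ler_peMr => //; exact: ltW.
rewrite /f /g in N1 G *.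
rewrite -/(g z) in N2 G *; rewrite -/(f z) in G N1.
have -> : B * (1 + (K + 1) * h) * V z = B * V z + h * (B * (K * V z)) + h * (B * V z).
  by ring.
have N2' : g z + h * generator g z - h * (e / 2) <= q' y z / m z by exact: N2.
lra.
Unshelve. all: by end_near. Qed.

(** The barrier vanishes with [e]; the inequality that remains holds for both orders of the two
    states, so it is an equality. *)
Lemma reversible t x y : 0 <= t -> m x * p t x y = m y * p t y x.
Proof.
move=> t0.
have le u v : p t u v / m v <= p t v u / m u.
  apply/ler_addgt0Pr => e e0.
  have V0 : 0 < V u by apply: lt_le_trans (V_ge1 u).
  have c0 : 0 < expR ((K + 1) * t) * V u by rewrite mulr_gt0// expR_gt0.
  have e'0 : 0 < e / (expR ((K + 1) * t) * V u) by rewrite divr_gt0.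
  have := reversible_le_barrier u v t0 e'0.
  by rewrite -mulrA divfK ?gt_eqF.
have E : p t x y / m y = p t y x / m x by apply/le_anti; rewrite !le.
rewrite -[p t x y](divfK (lt0r_neq0 (m_gt0 y))) E.
by field; exact: lt0r_neq0.
Qed.

End nonexplosion.
End detailed_balance.
End local_rates.

(** * Limits of reversible transition functions *)

(** The upper bound is checked on finite sums; applied again with the factor [c^-1], it gives the
    lower bound. *)
Lemma esumZ_fin (R : realType) (S : choiceType) (f : S -> R) (c M : R) :
  0 < c -> (forall x, 0 <= f x) -> \esum_(x in setT) (f x)%:E = M%:E ->
  \esum_(x in setT) (c * f x)%:E = (c * M)%:E.
Proof.
move=> c0 f0 fM.
have le (g : S -> R) (b N : R) : 0 < b -> (forall x, 0 <= g x) ->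
    (\esum_(x in setT) (g x)%:E <= N%:E)%E ->
    (\esum_(x in setT) (b * g x)%:E <= (b * N)%:E)%E.
  move=> b0 g0 gN; apply: esum_le_seq => [x|s us].
    by rewrite mulr_ge0// ltW.
  rewrite -mulr_sumr ler_pM2l// -lee_fin; apply: le_trans gN.
  exact: le_seq_esum.
have up : (\esum_(x in setT) (c * f x)%:E <= (c * M)%:E)%E.
  by apply: le => //; rewrite fM.
have lo0 : (0 <= \esum_(x in setT) (c * f x)%:E)%E.
  by apply: esum_ge0 => x _; rewrite lee_fin mulr_ge0// ltW.
case E : (\esum_(x in setT) (c * f x)%:E) up lo0 => [N| |]// up _.
apply/le_anti; rewrite up /= lee_fin.
have := le (fun x => c * f x) c^-1 N.
rewrite invr_gt0 E => /(_ c0 _ (lexx _)).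
under eq_esum do rewrite mulKf ?gt_eqF//.
rewrite fM lee_fin => H; rewrite -ler_pdivlMl//; apply: H => x.
by rewrite mulr_ge0// ltW.
Qed.

Section reversible_limit.
Context (R : realType) (S : choiceType) (rate : S -> S -> R).
Context (p : R -> S -> S -> R) (tf : transition_function rate p).
Context (m : S -> R) (m_gt0 : forall x, 0 < m x).
Context (rev : forall t x y, 0 <= t -> m x * p t x y = m y * p t y x).

Let p_ge0 t x y : 0 <= t -> 0 <= p t x y. Proof. exact: (tf_ge0 tf). Qed.

Lemma density_sym t x y : 0 <= t -> p t x y / m y = p t y x / m x.
Proof.
move=> t0; apply/eqP; rewrite eqr_div ?lt0r_neq0//; apply/eqP.
by rewrite [LHS]mulrC [RHS]mulrC rev.
Qed.

(** Chapman-Kolmogorov read as an inner product of two rows, after the second factor is reversed by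
    [density_sym]. *)
Lemma chapman_density s t x y : 0 <= s -> 0 <= t ->
  \esum_(z in setT) (p s x z * p t y z / m z)%:E = (p (s + t) x y / m y)%:E.
Proof.
move=> s0 t0; rewrite mulrC -(esumZ_fin (f := fun z => p s x z * p t z y)).
- apply: eq_esum => z _; congr EFin.
  by rewrite -mulrA -density_sym//; ring.
- by rewrite invr_gt0.
- by move=> z; rewrite mulr_ge0// p_ge0.
- by rewrite (tf_chapman_kolmogorov tf).
Qed.

(** The quadratic form of the symmetric kernel [p t x y / m y] at the sum of the unit masses at [x]
    and [y]; both cross terms are equal, hence the factor 2. *)
Definition energy x y t : R :=
  p t x x / m x + 2 * (p t x y / m y) + p t y y / m y.

Lemma energyE s t x y : 0 <= s -> 0 <= t ->
  \esum_(z in setT)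
    ((p s x z + p s y z) * (p t x z + p t y z) / m z)%:E =
  (energy x y (s + t))%:E.
Proof.
move=> s0 t0.
have ge0 u v z : (0 <= (p s u z * p t v z / m z)%:E)%E.
  by rewrite lee_fin divr_ge0 ?mulr_ge0 ?p_ge0// ltW.
rewrite (eq_esum (b := fun z => (p s x z * p t x z / m z)%:E
  + (p s x z * p t y z / m z)%:E + (p s y z * p t x z / m z)%:E
  + (p s y z * p t y z / m z)%:E)%E); last first.
  by move=> z _; rewrite -!EFinD; congr EFin; ring.
rewrite !esumD; try by move=> z _; rewrite ?adde_ge0.
rewrite !chapman_density// -!EFinD; congr EFin.
by rewrite /energy -(@density_sym _ x y) ?addr_ge0//; ring.
Qed.

Lemma energy_ge0 x y t : 0 <= t -> 0 <= energy x y t.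
Proof.
move=> t0; have g u v : 0 <= p t u v / m v.
  by apply: divr_ge0; [exact: p_ge0|exact: ltW].
by rewrite /energy !addr_ge0// mulr_ge0.
Qed.

(** Under the sum of [energyE] this is [2 * a * b <= a ^+ 2 + b ^+ 2], with [a] and [b] the values
    of [p s x + p s y] and [p t x + p t y] at one state. *)
Lemma energy_midpoint x y s t : 0 <= s -> 0 <= t ->
  2 * energy x y (s + t) <= energy x y (s + s) + energy x y (t + t).
Proof.
move=> s0 t0; rewrite mulr_natl mulr2n -lee_fin.
change ((energy x y (s + t))%:E + (energy x y (s + t))%:E <=
  (energy x y (s + s))%:E + (energy x y (t + t))%:E)%E.
rewrite -(@energyE s t)// -(@energyE s s)// -(@energyE t t)//.
have ge0 u v z : 0 <= u -> 0 <= v ->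
    (0 <= ((p u x z + p u y z) * (p v x z + p v y z) / m z)%:E)%E.
  move=> u0 v0.
  by rewrite lee_fin divr_ge0 ?mulr_ge0 ?addr_ge0 ?p_ge0// ltW.
rewrite -!esumD; try by move=> z _; exact: ge0.
apply: le_esum => z _; rewrite -!EFinD lee_fin -!mulrDl.
rewrite ler_pM2r ?invr_gt0//.
have := sqr_ge0 ((p s x z + p s y z) - (p t x z + p t y z)).
by rewrite sqrrB; lra.
Qed.

(* A bounded midpoint convex function on the half line is nonincreasing: its
   increments over steps of length [h] are nondecreasing, so a positive one
   would make it unbounded. *)
Lemma energy_nonincreasing x y t h : 0 <= t -> 0 <= h ->
  energy x y (t + h) <= energy x y t.
Proof.
move=> t0 h0; rewrite leNgt; apply/negP => lt.
set E := energy x y in lt *.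
have Eb s : 0 <= s -> E s <= (m x)^-1 + 2 * (m y)^-1 + (m y)^-1.
  move=> s0; rewrite /E /energy.
  have b u v : p s u v / m v <= (m v)^-1.
    by rewrite ler_piMl ?invr_ge0 ?(tf_le1 tf)// ltW.
  by have := b x x; have := b x y; have := b y y; lra.
set c := E (t + h) - E t; have c0 : 0 < c by rewrite subr_gt0.
have tn n : 0 <= t + n%:R * h by rewrite addr_ge0// mulr_ge0.
have incr n : c <= E (t + n.+1%:R * h) - E (t + n%:R * h).
  elim: n => [|n IH]; first by rewrite mul0r addr0 mul1r.
  apply: le_trans IH _.
  (* The times are halved because [energy_midpoint] evaluates the energy at sums of two times. *)
  have := @energy_midpoint x y ((t + n%:R * h) / 2) ((t + n.+2%:R * h) / 2).
  rewrite -!splitr -mulrDl => /(_ _ _)/wrap[]; rewrite ?divr_ge0//.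
  have -> : (t + n%:R * h + (t + n.+2%:R * h)) / 2 = t + n.+1%:R * h.
    by rewrite -(natr1 n.+1) -(natr1 n); field.
  by rewrite -/E; lra.
have lin n : E t + n%:R * c <= E (t + n%:R * h).
  elim: n => [|n IH]; first by rewrite !mul0r !addr0.
  by have := incr n; rewrite -(natr1 n) (mulrDl _ _ c) mul1r natr1; lra.
set B := (m x)^-1 + _ + _ in Eb.
have := lin (Num.trunc ((B - E t) / c)).+1.
have := truncnS_gt ((B - E t) / c).
rewrite ltr_pdivrMr//.
have := Eb _ (tn (Num.trunc ((B - E t) / c)).+1).
by lra.
Qed.

Lemma energy_cvg x y : cvg (energy x y t @[t --> +oo]).
Proof.
(* Clamping the time at 0 and changing the sign gives a function that is nondecreasing and bounded
   above on the whole line. *)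
pose f (t : R) : R := - energy x y (Num.max 0 t).
have fnd : nondecreasing_fun f.
  move=> s t st; rewrite lerN2.
  have ge s' : 0 <= Num.max 0 s' :> R by rewrite le_max lexx.
  have := @energy_nonincreasing x y (Num.max 0 s) (Num.max 0 t - Num.max 0 s).
  rewrite subrKC; apply => //; rewrite subr_ge0.
  by rewrite ge_max ge/= le_max st orbT.
have fub : has_ubound (range f).
  exists 0 => _ [t _ <-]; rewrite oppr_le0 energy_ge0//.
  by rewrite le_max lexx.
have H : - f @ +oo --> - sup (range f).
  by apply: cvgN; exact: nondecreasing_cvgr.
have E : {near +oo, - f =1 energy x y}.
  by near=> t; rewrite /f fctE opprK max_r//; near: t; exact: nbhs_pinfty_ge.
exact: (cvgP _ (cvg_trans (near_eq_cvg E) H)).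
Unshelve. all: by end_near. Qed.

Lemma reversible_cvg x y : cvg (p t x y @[t --> +oo]).
Proof.
(* Polarization; [energy x x] is four times the diagonal density, hence the divisions by 4. *)
have -> : (fun t => p t x y) = fun t => m y * ((energy x y t
    - energy x x t / 4 - energy y y t / 4) / 2).
  by apply/funext => t; rewrite /energy; field; rewrite !lt0r_neq0.
apply: is_cvgM; first exact: is_cvg_cst.
apply: is_cvgM; last exact: is_cvg_cst.
apply: is_cvgB; last by apply: is_cvgM; [exact: energy_cvg|exact: is_cvg_cst].
apply: is_cvgB; first exact: energy_cvg.
by apply: is_cvgM; [exact: energy_cvg|exact: is_cvg_cst].
Qed.

Definition plim x y : R := lim (p t x y @[t --> +oo]).

Lemma plim_cvg x y : p t x y @[t --> +oo] --> plim x y.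
Proof. exact: reversible_cvg. Qed.

Lemma plim_ge x y c : (forall t, 0 <= t -> c <= p t x y) -> c <= plim x y.
Proof.
move=> H; apply: limr_ge; first exact: reversible_cvg.
by near=> t; apply: H; near: t; exact: nbhs_pinfty_ge.
Unshelve. all: by end_near. Qed.

Lemma plim_sum_le x (a : S -> R) c s :
  (forall t, 0 <= t -> \sum_(z <- s) a z * p t x z <= c) ->
  \sum_(z <- s) a z * plim x z <= c.
Proof.
move=> H.
have C : \sum_(z <- s) a z * p t x z @[t --> +oo] -->
    \sum_(z <- s) a z * plim x z.
  apply: cvg_big => [|z _]; first exact: add_continuous.
  by apply: cvgM; [exact: cvg_cst|exact: plim_cvg].
rewrite -(cvg_lim _ C)//; apply: limr_le; first exact: (cvgP _ C).
by near=> t; apply: H; near: t; exact: nbhs_pinfty_ge.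
Unshelve. all: by end_near. Qed.

End reversible_limit.

(** * Properties of the limit kernel *)

Section reversible_limit_theory.
Context (R : realType) (S : choiceType) (rate : S -> S -> R).
Context (p : R -> S -> S -> R) (tf : transition_function rate p).
Context (nbr : S -> seq S) (nbr_uniq : forall x, uniq (nbr x)).
Context (nbr_irr : forall x, x \notin nbr x).
Context (rate_ge0 : forall x z, 0 <= rate x z).
Context (rate_nbr : forall x z, z != x -> z \notin nbr x -> rate x z = 0).
Context (m : S -> R) (m_gt0 : forall x, 0 < m x).
Context (rev : forall t x y, 0 <= t -> m x * p t x y = m y * p t y x).

Let p_cvg x y : p t x y @[t --> +oo] --> plim p x y.
Proof. exact: (plim_cvg tf m_gt0 rev). Qed.

Lemma plim_ge0 x y : 0 <= plim p x y.
Proof.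
by apply: (plim_ge tf m_gt0 rev) => t t0; exact: (tf_ge0 tf).
Qed.

Lemma plim_sum_le1 x s : uniq s -> \sum_(z <- s) plim p x z <= 1.
Proof.
move=> us; have := @plim_sum_le _ _ _ _ tf _ m_gt0 rev x (fun=> 1) 1 s.
under eq_bigr do rewrite mul1r.
apply => t t0; under eq_bigr do rewrite mul1r.
exact: (tf_sum_le1 tf).
Qed.

Lemma plim_le1 x y : plim p x y <= 1.
Proof. by have := @plim_sum_le1 x [:: y] isT; rewrite big_seq1. Qed.

Lemma plim_rev x y : m x * plim p x y = m y * plim p y x.
Proof.
have mp_cvg u v : m u * p t u v @[t --> +oo] --> m u * plim p u v.
  by apply: cvgM; [exact: cvg_cst|exact: p_cvg].
have E : {near +oo, (fun t => m y * p t y x) =1 (fun t => m x * p t x y)}.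
  by near=> t; rewrite rev//; near: t; exact: nbhs_pinfty_ge.
have H : m x * p t x y @[t --> +oo] --> m y * plim p y x.
  exact: cvg_trans (near_eq_cvg E) (mp_cvg y x).
by rewrite -(cvg_lim _ H)// (cvg_lim _ (mp_cvg x y)).
Unshelve. all: by end_near. Qed.

(** Reversibility turns this column sum into [m y] times a row sum of [plim], and row sums are at
    most 1. *)
Lemma plim_mass y s : uniq s -> \sum_(z <- s) m z * plim p z y <= m y.
Proof.
move=> us; under eq_bigr do rewrite plim_rev.
by rewrite -mulr_sumr ler_piMr ?plim_sum_le1// ltW.
Qed.

(** In [backward_step] one small [h] serves all [t]. As [t] grows, the increment over [h] vanishes,
    which leaves [h] times the generator bounded by [h * e]. *)
Lemma plim_harmonic x y : generator rate nbr (plim p ^~ y) x = 0.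
Proof.
apply/eqP; rewrite -normr_le0; apply/ler_addgt0Pr => e e0; rewrite add0r.
have := backward_step tf nbr_uniq nbr_irr rate_ge0 rate_nbr x e0.
move=> /(filterI (nbhs_right_gt 0)) /filter_ex[h [/= h0 H]].
pose D t := p (h + t) x y - p t x y - h * generator rate nbr (p t ^~ y) x.
have shift : (fun t : R => h + t) @ +oo --> +oo.
  apply/cvgryPge => A; near=> t; rewrite -lerBlDl; near: t.
  by apply: nbhs_pinfty_ge; exact: num_real.
have cD : D t @[t --> +oo] --> plim p x y - plim p x y -
    h * generator rate nbr (plim p ^~ y) x.
  apply: cvgB; first apply: cvgB.
  - by move=> A /p_cvg/shift.
  - exact: p_cvg.
  - apply: cvgM; [exact: cvg_cst|apply: cvg_big => [|z _]].
      exact: add_continuous.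
    by apply: cvgM; [exact: cvg_cst|apply: cvgB; exact: p_cvg].
have : `|plim p x y - plim p x y - h * generator rate nbr (plim p ^~ y) x|
    <= h * e.
  have cN : `|D t| @[t --> +oo] --> `|plim p x y - plim p x y -
      h * generator rate nbr (plim p ^~ y) x| by exact: cvg_norm.
  rewrite -(cvg_lim _ cN)//; apply: limr_le; first exact: (cvgP _ cN).
  by near=> t; apply: H; near: t; exact: nbhs_pinfty_ge.
by rewrite subrr sub0r normrN normrM gtr0_norm// ler_pM2l.
Unshelve. all: by end_near. Qed.

(* Cauchy-Schwarz for [p (t / 2) x], written as [a ^+ 2 / m + m / M ^+ 2 >=
   2 * a / M] in each term. *)
Lemma plim_diag_ge x M : 0 < M ->
  (forall s, uniq s -> \sum_(z <- s) m z <= M) -> m x / M <= plim p x x.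
Proof.
move=> M0 mM; apply: (plim_ge tf m_gt0 rev) => t t0.
have t20 : 0 <= t / 2 by rewrite divr_ge0.
have E1 : \esum_(z in setT) (2 / M * p (t / 2) x z)%:E = (2 / M)%:E.
  rewrite (esumZ_fin (M := 1)) ?mulr1//.
  - by rewrite divr_gt0.
  - by move=> z; exact: (tf_ge0 tf).
  - exact: (tf_mass1 tf).
have E2 : (\esum_(z in setT) (m z / M ^+ 2)%:E <= M^-1%:E)%E.
  apply: esum_le_seq => [z|s us]; first by rewrite divr_ge0 ?exprn_ge0// ltW.
  rewrite -mulr_suml ler_pdivrMr ?exprn_gt0//.
  by rewrite expr2 mulrA mulVf ?mul1r ?mM ?lt0r_neq0.
have := chapman_density tf m_gt0 rev x x t20 t20; rewrite -splitr => E3.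
suff : 2 / M <= p t x x / m x + M^-1.
  rewrite -lerBlDr => H; rewrite -ler_pdivlMl// [_^-1 * _]mulrC.
  by apply: le_trans H; rewrite lerBrDr; lra.
rewrite -lee_fin -E1 EFinD -E3; apply: le_trans (leeD2l _ E2).
rewrite -esumD.
- apply: le_esum => z _; rewrite -EFinD lee_fin.
  set a := p _ x z.
  have -> : a * a / m z + m z / M ^+ 2 = 2 / M * a + (a - m z / M) ^+ 2 / m z.
    by field; rewrite !lt0r_neq0.
  by rewrite lerDl divr_ge0 ?sqr_ge0// ltW.
- by move=> z _; rewrite lee_fin divr_ge0 ?mulr_ge0 ?(tf_ge0 tf)// ltW.
- by move=> z _; rewrite lee_fin divr_ge0 ?exprn_ge0// ltW.
Qed.

End reversible_limit_theory.

(** * The binomial series *)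

Section binomial_series.
Context (R : realType) (a : R) (a_gt0 : 0 < a).

Let c k : R := pochhammer a k / k`!%:R.

Lemma pochhammer_factS k : k.+1%:R * (pochhammer a k.+1 / k.+1`!%:R) =
  (a + k%:R) * (pochhammer a k / k`!%:R).
Proof.
rewrite /pochhammer big_nat_recr//= factS natrM; field.
by rewrite nat1r !pnatr_eq0 -lt0n fact_gt0.
Qed.

Lemma pochhammer_gt0 k : 0 < pochhammer a k.
Proof.
elim: k => [|k IH]; first by rewrite /pochhammer big_geq.
by rewrite /pochhammer big_nat_recr//= mulr_gt0// ltr_wpDr.
Qed.

Lemma pochhammer_fact_gt0 k : 0 < pochhammer a k / k`!%:R.
Proof. by rewrite divr_gt0 ?pochhammer_gt0// ltr0n fact_gt0. Qed.

(** By the recursion, [k] times the [k]-th coefficient is nondecreasing, and it equals [a] at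
    [k = 1]. This is the comparison with the harmonic series used when [mu <= lambda]. *)
Lemma pochhammer_fact_ge k : a / k.+1%:R <= pochhammer a k.+1 / k.+1`!%:R.
Proof.
elim: k => [|k IH].
  by rewrite /pochhammer big_nat1 addr0.
rewrite -(ler_pM2l (ltr0Sn R k.+1)) pochhammer_factS mulrCA divff// mulr1.
have k0 : 0 < k.+1%:R :> R by [].
apply: (@le_trans _ _ (k.+1%:R * (pochhammer a k.+1 / k.+1`!%:R))).
  by rewrite -ler_pdivrMl// [_^-1 * _]mulrC.
by rewrite ler_pM2r ?pochhammer_fact_gt0// lerDr ltW.
Qed.

Let is_derive_pow (x : R) : x < 1 ->
  is_derive x 1 (fun x : R => (1 - x) `^ a) (- (a * (1 - x) `^ a / (1 - x))).
Proof.
move=> x1; have x0 : 0 < 1 - x by rewrite subr_gt0.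
have -> : (fun x : R => (1 - x) `^ a) = (fun y : R => y `^ a) \o (cst 1 - id).
  by apply/funext.
have D1 : is_derive x 1 (cst 1 - id : R -> R) (0 - 1) by exact: is_deriveB.
apply: (is_derive_eq (is_derive1_comp _ D1)) => /=; first exact: is_derive1_powR.
rewrite powRB; last by apply/implyP => _; rewrite gt_eqF.
by rewrite powRr1 ?ltW// sub0r mulrN1 mulrA.
Qed.

(* The derivative telescopes because the coefficients satisfy
   [(k + 1) * c (k + 1) = (a + k) * c k]. *)
Let is_derive_partial n (x : R) : x < 1 ->
  is_derive x 1 (fun x : R => (\sum_(0 <= k < n.+1) c k * x ^+ k) * (1 - x) `^ a)
    (- ((a + n%:R) * c n * x ^+ n * (1 - x) `^ a / (1 - x))).
Proof.
move=> x1; have x0 : 1 - x != 0 by rewrite subr_eq0 gt_eqF.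
elim: n => [|n IH].
  have -> : (fun x : R => (\sum_(0 <= k < 1) c k * x ^+ k) * (1 - x) `^ a) =
      (fun x : R => (1 - x) `^ a).
    apply/funext => y.
    by rewrite big_nat1 /c /pochhammer big_geq// fact0 divr1 !mul1r.
  apply: (is_derive_eq (is_derive_pow x1)).
  by rewrite /c /pochhammer big_geq// fact0 divr1 addr0 !mulr1.
have -> : (fun x : R => (\sum_(0 <= k < n.+2) c k * x ^+ k) * (1 - x) `^ a) =
    (fun x : R => (\sum_(0 <= k < n.+1) c k * x ^+ k) * (1 - x) `^ a) \+
    (fun x : R => c n.+1 * (x ^+ n.+1 * (1 - x) `^ a)).
  by apply/funext => y /=; rewrite big_nat_recr//= mulrDl mulrA.
have D1 : is_derive x 1 (fun x : R => x ^+ n.+1) (n.+1%:R * x ^+ n).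
  have -> : (fun x : R => x ^+ n.+1) = id ^+ n.+1.
    by apply/funext => y; rewrite exprfctE.
  by apply: is_derive_eq; rewrite /GRing.scale /= mulr1.
have D2 := is_deriveM D1 (is_derive_pow x1).
have D3 := is_deriveZ (c n.+1) D2.
apply: (is_derive_eq (is_deriveD IH D3)).
rewrite /GRing.scale /=.
have -> : (a + n%:R) * c n = n.+1%:R * c n.+1 by rewrite /c pochhammer_factS.
by rewrite -natr1 exprS; field.
Qed.

(** Ratio test: the quotient of consecutive terms tends to [r], so it is eventually below
    [q = (1 + r) / 2 < 1]. *)
Lemma ratio_cvg0 (r : R) : 0 < r -> r < 1 ->
  (a + n%:R) * (pochhammer a n / n`!%:R) * r ^+ n @[n --> \oo] --> 0.
Proof.
move=> r0 r1; pose T n := (a + n%:R) * c n * r ^+ n.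
have T0 n : 0 < T n.
  by rewrite mulr_gt0 ?exprn_gt0// mulr_gt0 ?pochhammer_fact_gt0// ltr_wpDr.
have TS n : T n.+1 = (a + n.+1%:R) / n.+1%:R * r * T n.
  rewrite /T -[(a + n%:R) * c n]pochhammer_factS -/(c n.+1) exprS; field.
  by rewrite nat1r pnatr_eq0.
pose q := (1 + r) / 2.
have q1 : `|q| < 1 by rewrite ger0_norm /q; lra.
(* The condition [(a + n) / n * r <= q] amounts to [2 * a * r / (1 - r) <= n]. *)
pose N := (Num.trunc (2 * a * r / (1 - r))).+1.
have TN n : (N <= n.+1)%N -> T n.+1 <= q * T n.
  move=> Nn; rewrite TS ler_pM2r//.
  have n0 : 0 < n.+1%:R :> R by [].
  rewrite mulrAC ler_pdivrMr//.
  have : 2 * a * r / (1 - r) < n.+1%:R.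
    by apply: lt_le_trans (truncnS_gt _) _; rewrite ler_nat.
  by rewrite ltr_pdivrMr ?subr_gt0// /q; lra.
have Tq n : T (N + n)%N <= T N * q ^+ n.
  elim: n => [|n IH]; first by rewrite addn0 mulr1.
  rewrite addnS exprS mulrCA; apply: le_trans (TN _ _) _.
    by rewrite -addnS leq_addr.
  by rewrite ler_pM2l// /q; lra.
rewrite -(cvg_shiftn N).
apply: (squeeze_cvgr (f := cst 0) (h := geometric (T N) q)).
- near=> n; apply/andP; split; first exact: (ltW (T0 _)).
  by have := Tq n; rewrite addnC.
- exact: cvg_cst.
- exact: cvg_geometric.
Unshelve. all: by end_near. Qed.

Lemma binomial_series_partial (r : R) n : 0 < r -> r < 1 ->
  exists2 e, 0 <= e <= (a + n%:R) * (pochhammer a n / n`!%:R) * r ^+ n / (1 - r) &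
  (\sum_(0 <= k < n.+1) pochhammer a k / k`!%:R * r ^+ k) * (1 - r) `^ a = 1 - e.
Proof.
move=> r0 r1.
have D x : x \in `]0, r[%R -> is_derive x 1
    (fun x : R => (\sum_(0 <= k < n.+1) c k * x ^+ k) * (1 - x) `^ a)
    (- ((a + n%:R) * c n * x ^+ n * (1 - x) `^ a / (1 - x))).
  by rewrite in_itv /= => /andP[_ xr]; apply: is_derive_partial; exact: lt_trans r1.
have C : {within `[0, r], continuous
    (fun x : R => (\sum_(0 <= k < n.+1) c k * x ^+ k) * (1 - x) `^ a)}.
  apply: derivable_within_continuous => x; rewrite in_itv /= => /andP[_ xr].
  by apply: ex_derive; apply: is_derive_partial; exact: le_lt_trans r1.
have [x] := MVT r0 D C.
rewrite in_itv /= => /andP[x0 xr] E.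
set A := (a + n%:R) * c n in D E *.
clear D.
pose e := A * x ^+ n * (1 - x) `^ a / (1 - x) * r.
have x1 : x < 1 by exact: lt_trans r1.
have A0 : 0 < A.
  by rewrite mulr_gt0 ?pochhammer_fact_gt0// ltr_wpDr.
clearbody A.
have d0 : 0 < 1 - x by rewrite subr_gt0.
have d1 : 0 < 1 - r by rewrite subr_gt0.
have w0 : 0 < (1 - x) `^ a by exact: powR_gt0.
have w1 : (1 - x) `^ a <= 1.
  have := @ge0_ler_powR R a (ltW a_gt0) (1 - x) 1.
  by rewrite powR1; apply; rewrite ?nnegrE ?(ltW d0)// gerBl ltW.
exists e.
  rewrite /e; apply/andP; split.
    have xn0 : 0 < x ^+ n by exact: exprn_gt0.
    by apply/ltW/mulr_gt0 => //; apply: divr_gt0 => //; rewrite !mulr_gt0.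
  have -> : forall u v w z : R, u * v * w / z * r = u * (v * (w * (r / z))).
    by move=> *; ring.
  rewrite -[leRHS]mulrA ler_pM2l//.
  apply: ler_pM; rewrite ?exprn_ge0 ?mulr_ge0 ?invr_ge0 ?(ltW w0) ?(ltW r0)
    ?(ltW x0) ?(ltW d0)//.
    by apply: lerXn2r; rewrite ?nnegrE ltW.
  rewrite -[leRHS]mul1r; apply: ler_pM => //;
    rewrite ?divr_ge0 ?(ltW w0) ?(ltW r0) ?(ltW d0)//.
  by rewrite ler_pdivrMr// ler_pdivlMl//; nra.
have G0 : (\sum_(0 <= k < n.+1) c k * 0 ^+ k) * (1 - 0) `^ a = 1.
  rewrite subr0 powR1 mulr1 big_nat_recl//= big1 ?addr0.
    by rewrite /c /pochhammer big_geq// fact0 divr1 mulr1.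
  by move=> k _; rewrite expr0n mulr0.
by move: E; rewrite G0 [r - 0]subr0 mulNr -/e => E; lra.
Qed.

Lemma binomial_series_le (r : R) n : 0 < r -> r < 1 ->
  \sum_(0 <= k < n.+1) pochhammer a k / k`!%:R * r ^+ k <= ((1 - r) `^ a)^-1.
Proof.
move=> r0 r1; have [e /andP[e0 _] E] := binomial_series_partial n r0 r1.
rewrite -[leRHS]mul1r ler_pdivlMr ?powR_gt0 ?subr_gt0// E.
by rewrite gerBl.
Qed.

Lemma binomial_series_cvg (r : R) : 0 < r -> r < 1 ->
  \sum_(0 <= k < n.+1) pochhammer a k / k`!%:R * r ^+ k @[n --> \oo] -->
  ((1 - r) `^ a)^-1.
Proof.
move=> r0 r1; set u := (1 - r) `^ a.
have u0 : 0 < u by rewrite powR_gt0// subr_gt0.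
pose b n := (a + n%:R) * (pochhammer a n / n`!%:R) * r ^+ n.
have cb : u^-1 - b n * ((1 - r)^-1 * u^-1) @[n --> \oo] --> u^-1.
  rewrite -[X in _ --> X]subr0 -(mul0r ((1 - r)^-1 * u^-1)).
  apply: cvgB; first exact: cvg_cst.
  by apply: cvgM; [exact: ratio_cvg0|exact: cvg_cst].
apply: (squeeze_cvgr _ cb (cvg_cst u^-1)).
near=> n; rewrite binomial_series_le// andbT.
have [e /andP[_ e1] E] := binomial_series_partial n r0 r1.
rewrite -(ler_pM2r u0) E mulrBl mulVf ?gt_eqF// lerD2l lerN2.
suff -> : b n * ((1 - r)^-1 * u^-1) * u = b n / (1 - r) by exact: e1.
by rewrite mulrA divfK ?gt_eqF.
Unshelve. all: by end_near. Qed.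

End binomial_series.

(** * The birth-death process on the star *)

Section star.
Context (R : realType) (d : nat) (alpha lambda mu : R).
Context (alpha_gt0 : 0 < alpha) (lambda_gt0 : 0 < lambda) (mu_gt0 : 0 < mu).

Local Notation rate := (star_rate alpha lambda mu (d := d)).

(* Since [(0, j)] is not a state for [j > 0], [st 0 j] falls back to the origin:
   this is the identification of [(0, j)] with [(0, 0)]. *)
Definition st (k j : nat) : state d := insubd (origin d) (k, j).

Lemma st0 j : st 0 j = origin d.
Proof.
apply: val_inj; rewrite val_insubd; case: ifP => //.
by rewrite /in_state orbF => /eqP.
Qed.

Lemma val_stS k j : (1 <= j <= d)%N -> val (st k.+1 j) = (k.+1, j).
Proof. by move=> jd; rewrite insubdK// /in_state unfold_in /= jd orbT. Qed.

Lemma st_fst k j : (1 <= j <= d)%N -> (val (st k j)).1 = k.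
Proof. by case: k => [|k] jd; rewrite ?st0// val_stS. Qed.

Variant state_spec : state d -> Prop :=
| StateOrigin : state_spec (origin d)
| StateBranch k j of (1 <= j <= d)%N : state_spec (st k.+1 j).

Lemma stateP x : state_spec x.
Proof.
case: x => -[k j] kj; case/orP: (kj) => [/eqP[k0 j0]|/= /andP[k0 jd]].
  suff -> : exist _ (k, j) kj = origin d by constructor.
  by apply: val_inj; rewrite /= k0 j0.
case: k kj k0 => // k kj _.
suff -> : exist _ (k.+1, j) kj = st k.+1 j by constructor.
by apply: val_inj; rewrite val_stS.
Qed.

Lemma st_inj k j l i : (1 <= j <= d)%N -> (1 <= i <= d)%N ->
  (st k.+1 j == st l.+1 i) = (k == l) && (j == i).
Proof. by move=> jd id; rewrite -val_eqE !val_stS. Qed.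

Lemma st_neq0 k j : (1 <= j <= d)%N -> (st k.+1 j == origin d) = false.
Proof. by move=> jd; rewrite -val_eqE val_stS. Qed.

Lemma rate_out k j : (1 <= j <= d)%N ->
  rate (origin d) (st k.+1 j) = if k == 0%N then alpha else 0.
Proof. by move=> jd; rewrite /star_rate val_stS. Qed.

Lemma rate_in k j : (1 <= j <= d)%N ->
  rate (st k.+1 j) (origin d) = if k == 0%N then mu else 0.
Proof.
move=> jd; rewrite /star_rate val_stS//= andbT eq_sym.
by case: eqP => [->|//]; rewrite mulr1.
Qed.

Lemma rate_branch k j l i : (1 <= j <= d)%N -> (1 <= i <= d)%N ->
  rate (st k.+1 j) (st l.+1 i) =
  if (l == k.+1) && (i == j) then alpha + lambda * k.+1%:R
  else if (l.+1 == k) && (i == j) then mu * k.+1%:R else 0.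
Proof. by move=> jd id; rewrite /star_rate !val_stS. Qed.

Lemma star_rate_ge0 x z : 0 <= rate x z.
Proof.
rewrite /star_rate; case: (val x) => k i; case: (val z) => l j.
by do !case: ifP => _ //; rewrite ?addr_ge0 ?mulr_ge0 ?(ltW alpha_gt0)
  ?(ltW lambda_gt0) ?(ltW mu_gt0).
Qed.

Definition weight k : R :=
  pochhammer (alpha / lambda) k / k`!%:R * (lambda / mu) ^+ k.

Lemma weight0 : weight 0 = 1.
Proof. by rewrite /weight /pochhammer big_geq// fact0 divr1 mulr1. Qed.

(** Detailed balance between adjacent levels of one branch. *)
Lemma weightS k : mu * k.+1%:R * weight k.+1 = (alpha + lambda * k%:R) * weight k.
Proof.
have := pochhammer_factS (alpha / lambda) k.
rewrite /weight exprS; set A := _ / _`!%:R; set B := _ / _`!%:R => E.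
have -> : mu * k.+1%:R * (A * (lambda / mu * (lambda / mu) ^+ k)) =
  lambda * (lambda / mu) ^+ k * (k.+1%:R * A) by field; rewrite gt_eqF.
by rewrite E; field; rewrite !gt_eqF.
Qed.

Lemma weight_gt0 k : 0 < weight k.
Proof.
apply: mulr_gt0; last by rewrite exprn_gt0 ?divr_gt0.
by apply: pochhammer_fact_gt0; rewrite divr_gt0.
Qed.

Definition measure_star (x : state d) : R := weight (val x).1.
Local Notation m := measure_star.

Lemma measure_st k j : (1 <= j <= d)%N -> m (st k j) = weight k.
Proof. by move=> jd; rewrite /m st_fst. Qed.

Lemma measure_origin : m (origin d) = 1.
Proof. by rewrite /m weight0. Qed.

Lemma measure_gt0 x : 0 < m x.
Proof. exact: weight_gt0. Qed.

Lemma star_balance x z : m x * rate x z = m z * rate z x.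
Proof.
have w1 : alpha = mu * weight 1.
  by have := weightS 0; rewrite weight0 mulr0 addr0 !mulr1.
have W := weightS.
case: (stateP x) => [|k j jd]; case: (stateP z) => [|l i id] //.
- rewrite rate_out// rate_in// measure_origin measure_st//.
  by case: eqP => [->|_]; rewrite ?mulr0// mul1r mulrC -w1.
- rewrite rate_out// rate_in// measure_origin measure_st//.
  by case: eqP => [->|_]; rewrite ?mulr0// mul1r mulrC -w1.
- rewrite !rate_branch// !measure_st// [i == j]eq_sym.
  have [_|_] := eqVneq j i; rewrite ?andbF ?mulr0// !andbT.
  have [->|_] := eqVneq l k.+1; first by rewrite ltn_eqF// mulrC -W mulrC.
  have [<-|_] := eqVneq l.+1 k; first by rewrite mulrC W mulrC.
  by rewrite !mulr0.
Qed.

(** At level 1 the entry [st k.-1 j] is the origin, so that level needs no case of its own. *)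
Definition star_nbr (x : state d) : seq (state d) :=
  let: (k, j) := val x in
  if k == 0%N then [seq st 1 i | i <- iota 1 d] else [:: st k.+1 j; st k.-1 j].

Let mem_iota1 j : (j \in iota 1 d) = (1 <= j <= d)%N.
Proof. by rewrite mem_iota add1n ltnS. Qed.

Lemma star_nbr_origin : star_nbr (origin d) = [seq st 1 j | j <- iota 1 d].
Proof. by []. Qed.

Lemma star_nbr_branch k j : (1 <= j <= d)%N ->
  star_nbr (st k.+1 j) = [:: st k.+2 j; st k j].
Proof. by move=> jd; rewrite /star_nbr val_stS. Qed.

Lemma star_nbr_uniq x : uniq (star_nbr x).
Proof.
case: (stateP x) => [|k j jd].
  rewrite star_nbr_origin map_inj_in_uniq ?iota_uniq// => i j.
  by rewrite !mem_iota1 => id jd /eqP; rewrite st_inj// => /eqP.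
rewrite star_nbr_branch//= inE andbT -val_eqE val_stS//.
by case: k => [|k]; rewrite ?st0// val_stS// xpair_eqE gtn_eqF.
Qed.

Lemma star_nbr_irr x : x \notin star_nbr x.
Proof.
case: (stateP x) => [|k j jd].
  by apply/mapP => -[j]; rewrite mem_iota1 => jd /esym/eqP; rewrite st_neq0.
rewrite star_nbr_branch// !inE st_inj// ltn_eqF//=.
by case: k => [|k]; rewrite ?st0 ?st_neq0// st_inj// gtn_eqF.
Qed.

Lemma star_rate_nbr x z : z != x -> z \notin star_nbr x -> rate x z = 0.
Proof.
case: (stateP x) => [|k j jd]; case: (stateP z) => [|l i id] // _.
- rewrite star_nbr_origin rate_out//; case: l => //= /mapP[].
  by exists i => //; rewrite mem_iota1.
- rewrite star_nbr_branch// rate_in//; case: k => //.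
  by rewrite !inE st0 eqxx orbT.
- rewrite star_nbr_branch// rate_branch// !inE st_inj// negb_or => /andP[/negbTE->].
  by case: k => [|k]; rewrite // st_inj// eqSS => /negbTE ->.
Qed.

Local Notation gen := (generator rate star_nbr).

Lemma generator_origin f :
  gen f (origin d) = alpha * \sum_(j <- iota 1 d) (f (st 1 j) - f (origin d)).
Proof.
rewrite /generator star_nbr_origin big_map mulr_sumr big_seq [RHS]big_seq.
by apply: eq_bigr => j; rewrite mem_iota1 => jd; rewrite rate_out.
Qed.

Lemma generator_branch f k j : (1 <= j <= d)%N ->
  gen f (st k.+1 j) = (alpha + lambda * k.+1%:R) * (f (st k.+2 j) - f (st k.+1 j))
    - mu * k.+1%:R * (f (st k.+1 j) - f (st k j)).
Proof.
move=> jd; rewrite /generator star_nbr_branch// big_cons big_seq1 -mulrN opprB.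
rewrite rate_branch// !eqxx; congr (_ + _ * _).
case: k => [|k]; first by rewrite st0 rate_in// mulr1.
by rewrite rate_branch// ltn_eqF// !eqxx.
Qed.

Definition lyapunov (x : state d) : R := 1 + (val x).1%:R.

Lemma lyapunov_st k j : (1 <= j <= d)%N -> lyapunov (st k j) = k.+1%:R.
Proof. by move=> jd; rewrite /lyapunov st_fst// nat1r. Qed.

Lemma lyapunov_ge1 x : 1 <= lyapunov x.
Proof. by rewrite lerDl. Qed.

(** The drift of the level is [alpha * d] at the origin, from its [d] exits, and
    [alpha + (lambda - mu) * k] at level [k] of a branch. *)
Lemma lyapunov_generator x :
  gen lyapunov x <= (alpha * d%:R + alpha + lambda) * lyapunov x.
Proof.
case: (stateP x) => [|k j jd].
  rewrite generator_origin /lyapunov /= addr0 mulr1.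
  rewrite big_seq (eq_bigr (fun=> 1)); last first.
    by move=> j; rewrite mem_iota1 => jd; rewrite st_fst//; ring.
  rewrite -big_seq big_const_seq count_predT size_iota iter_addr_0 -addrA lerDl.
  by rewrite addr_ge0// ltW.
rewrite generator_branch// !lyapunov_st//.
have E n : n.+1%:R - n%:R = 1 :> R by rewrite -natr1 addrAC subrr add0r.
rewrite !E !mulr1.
have k1 : 1 <= k.+1%:R :> R by rewrite ler1n.
have k2 : k.+2%:R = k.+1%:R + 1 :> R by rewrite natr1.
have ad : 0 <= alpha * d%:R by rewrite mulr_ge0// ltW.
rewrite k2; set n := k.+1%:R in k1 *.
have := ltW alpha_gt0; have := ltW lambda_gt0; have := ltW mu_gt0.
nra.
Qed.

(** The states of level at most [n]; the origin is listed apart because all [st 0 j] coincide. *)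
Definition ball n : seq (state d) :=
  origin d :: [seq st k.+1 j | k <- iota 0 n, j <- iota 1 d].

Lemma ball_uniq n : uniq (ball n).
Proof.
rewrite /= allpairs_uniq ?iota_uniq ?andbT//.
  apply/allpairsP => -[[k j] /= []]; rewrite mem_iota1 => _ jd /esym/eqP.
  by rewrite st_neq0.
move=> [k j] [l i] /allpairsP[[k' j'] /= [_ jd [-> ->]]].
move=> /allpairsP[[l' i'] /= [_ id [-> ->]]] /eqP.
by move: jd id; rewrite !mem_iota1 => jd id; rewrite st_inj// => /andP[/eqP-> /eqP->].
Qed.

Lemma mem_ball x n : ((val x).1 <= n)%N -> x \in ball n.
Proof.
case: (stateP x) => [_|k j jd]; first exact: mem_head.
rewrite val_stS// inE => kn; apply/orP; right; apply/allpairsP.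
by exists (k, j); rewrite /= mem_iota1 mem_iota.
Qed.

Lemma sum_measure_ball f n : \sum_(x <- ball n) m x * f x =
  f (origin d) + \sum_(0 <= k < n) weight k.+1 * \sum_(j <- iota 1 d) f (st k.+1 j).
Proof.
rewrite big_cons measure_origin mul1r big_allpairs_dep /index_iota subn0.
congr (_ + _); apply: eq_bigr => k _; rewrite mulr_sumr big_seq [RHS]big_seq.
by apply: eq_bigr => j; rewrite mem_iota1 => jd; rewrite measure_st.
Qed.

Lemma lyapunov_finite c :
  exists s : seq (state d), forall x, lyapunov x <= c -> x \in s.
Proof.
exists (ball (Num.trunc c)) => x xc; apply: mem_ball.
rewrite -ltnS -(ltr_nat R); apply: le_lt_trans (truncnS_gt c).
by apply: le_trans xc; rewrite /lyapunov lerDr.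
Qed.

(** * Harmonic functions on the star *)

Section harmonic.
Context (f : state d -> R) (f_harmonic : forall x, gen f x = 0).

Lemma harmonic_origin : \sum_(j <- iota 1 d) (f (st 1 j) - f (st 0 j)) = 0.
Proof.
have /eqP := f_harmonic (origin d); rewrite generator_origin mulf_eq0.
rewrite gt_eqF//= => /eqP; apply: etrans.
by apply: eq_bigr => j _; rewrite st0.
Qed.

(** Each increment along a branch is thus a positive multiple of the previous one, so the first
    increment fixes the sign of all. *)
Lemma harmonic_step k j : (1 <= j <= d)%N ->
  (alpha + lambda * k.+1%:R) * (f (st k.+2 j) - f (st k.+1 j)) =
  mu * k.+1%:R * (f (st k.+1 j) - f (st k j)).
Proof.
move=> jd; have := f_harmonic (st k.+1 j); rewrite generator_branch//.
by move=> /eqP; rewrite subr_eq0 => /eqP.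
Qed.

Let c_gt0 k : 0 < alpha + lambda * k.+1%:R.
Proof. by rewrite addr_gt0// mulr_gt0. Qed.

Lemma harmonic_monotone k j : (1 <= j <= d)%N -> f (origin d) <= f (st 1 j) ->
  0 <= f (st k.+1 j) - f (st k j).
Proof.
move=> jd f1; elim: k => [|k IH]; first by rewrite st0 subr_ge0.
rewrite -(pmulr_rge0 _ (c_gt0 k)) harmonic_step//.
by rewrite mulr_ge0// mulr_ge0// ltW.
Qed.

Lemma harmonic_ge_origin k j : (1 <= j <= d)%N -> f (origin d) <= f (st 1 j) ->
  f (origin d) <= f (st k j).
Proof.
move=> jd f1; elim: k => [|k]; first by rewrite st0.
by move=> /le_trans; apply; rewrite -subr_ge0 harmonic_monotone.
Qed.

Lemma harmonic_gt k j : (1 <= j <= d)%N -> f (origin d) < f (st 1 j) ->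
  0 < f (st k.+1 j) - f (st k j).
Proof.
move=> jd f1; elim: k => [|k IH]; first by rewrite st0 subr_gt0.
rewrite -(pmulr_rgt0 _ (c_gt0 k)) harmonic_step//.
by rewrite mulr_gt0// mulr_gt0.
Qed.

(* For [k] beyond [alpha / (mu - lambda)] the increments of [f] along a branch
   are nondecreasing, so a positive first increment makes [f] unbounded. *)
Lemma harmonic_bounded_le j : lambda < mu -> (forall x, 0 <= f x <= 1) ->
  (1 <= j <= d)%N -> f (st 1 j) <= f (origin d).
Proof.
move=> lm f01 jd; rewrite leNgt; apply/negP => f1.
pose D k := f (st k.+1 j) - f (st k j).
have D0 k : 0 < D k by exact: harmonic_gt.
pose N := Num.trunc (alpha / (mu - lambda)).
have Dle k : (N <= k)%N -> D k <= D k.+1.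
  move=> Nk; rewrite -(ler_pM2l (c_gt0 k)) /D harmonic_step// ler_pM2r ?D0//.
  have : alpha / (mu - lambda) < k.+1%:R.
    by apply: lt_le_trans (truncnS_gt _) _; rewrite ler_nat ltnS.
  by rewrite ltr_pdivrMr ?subr_gt0//; nra.
have DN i : D N <= D (N + i)%N.
  elim: i => [|i IH]; first by rewrite addn0.
  by rewrite addnS; apply: le_trans IH (Dle _ _); exact: leq_addr.
have fi i : i%:R * D N <= f (st (N + i) j).
  elim: i => [|i IH]; first by rewrite mul0r; case/andP: (f01 (st (N + 0) j)).
  by have := DN i; rewrite {2}/D addnS -natr1; lra.
(* More than [1 / D N] increments, each at least [D N], push [f] above 1. *)
pose M := (Num.trunc (D N)^-1).+1.
have /andP[_ M1] := f01 (st (N + M) j).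
have := truncnS_gt (D N)^-1; rewrite -/M.
have := fi M; have := D0 N; set x := D N => x0 H1 H2.
have : x^-1 * x < M%:R * x by rewrite ltr_pM2r.
by rewrite mulVf ?gt_eqF//; lra.
Qed.

(** No first increment is positive and they sum to zero over the branches, so all of them vanish;
    [harmonic_step] then carries this outwards. *)
Lemma harmonic_bounded_constant x : lambda < mu -> (forall x, 0 <= f x <= 1) ->
  f x = f (origin d).
Proof.
move=> lm f01.
have f1 j : (1 <= j <= d)%N -> f (st 1 j) = f (st 0 j).
  move=> jd; have /eqP : \sum_(j <- iota 1 d | (1 <= j <= d)%N)
      (f (st 0 j) - f (st 1 j)) = 0.
    under eq_bigl do rewrite -mem_iota1.
    rewrite -big_seq; have := congr1 -%R harmonic_origin.
    rewrite oppr0 -sumrN; apply: etrans.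
    by apply: eq_bigr => i _; rewrite opprB.
  rewrite psumr_eq0 => [/allP /(_ j)|i id].
    by rewrite mem_iota1 jd subr_eq0 => /(_ isT)/eqP.
  by rewrite st0 subr_ge0 harmonic_bounded_le.
case: (stateP x) => [//|k j jd].
have D0 i : f (st i.+1 j) - f (st i j) = 0.
  elim: i => [|i IH]; first by rewrite f1// subrr.
  apply/eqP; have /eqP := harmonic_step i jd.
  by rewrite IH mulr0 mulf_eq0 gt_eqF.
elim: k => [|k IH]; first by rewrite f1// st0.
by rewrite -IH; apply/eqP; rewrite -subr_eq0 D0.
Qed.

(** The first increments sum to zero over a nonempty set of branches, so they are not all
    negative. *)
Lemma exists_increasing_branch : (0 < d)%N ->
  exists2 j, (1 <= j <= d)%N & f (origin d) <= f (st 1 j).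
Proof.
move=> d0; apply: contrapT => H.
have lt j : (1 <= j <= d)%N -> f (st 1 j) - f (st 0 j) < 0.
  move=> jd; rewrite st0 subr_lt0 ltNge; apply/negP => f1.
  by apply: H; exists j.
have : \sum_(j <- iota 1 d) (f (st 1 j) - f (st 0 j)) < 0.
  rewrite -(prednK d0) /= big_cons -[ltRHS]addr0 ltr_leD ?lt//.
  rewrite big_seq; apply: sumr_le0 => j; rewrite mem_iota add2n => /andP[j1 jd].
  by apply/ltW/lt; rewrite (ltnW j1) -(prednK d0) -ltnS.
by rewrite harmonic_origin ltxx.
Qed.

End harmonic.

(** * Long-time limits on the star *)

Section limits.
Context (p : R -> state d -> state d -> R) (tf : transition_function rate p).

Lemma star_rev t x y : 0 <= t -> m x * p t x y = m y * p t y x.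
Proof.
have K0 : 0 <= alpha * d%:R + alpha + lambda.
  by rewrite !addr_ge0 ?mulr_ge0// ltW.
exact: (reversible tf star_nbr_uniq star_nbr_irr star_rate_ge0 star_rate_nbr
  measure_gt0 star_balance lyapunov_ge1 K0 lyapunov_finite lyapunov_generator).
Qed.

Let plim_harm y x : gen (plim p ^~ y) x = 0.
Proof.
exact: (plim_harmonic tf star_nbr_uniq star_nbr_irr star_rate_ge0 star_rate_nbr
  measure_gt0 star_rev).
Qed.

Let plim0 x y : 0 <= plim p x y.
Proof. exact: (plim_ge0 tf measure_gt0 star_rev). Qed.

Lemma weight_ge k : mu <= lambda -> alpha / lambda / k.+1%:R <= weight k.+1.
Proof.
move=> ml; rewrite -[leLHS]mulr1; apply: ler_pM => //.
- by rewrite !divr_ge0// ltW.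
- by apply: pochhammer_fact_ge; rewrite divr_gt0.
- by rewrite exprn_ege1// ler_pdivlMr// mul1r.
Qed.

(** If [f (origin d) > 0], then [f] stays above this value along some branch, whose weights dominate
    a multiple of the harmonic series; the bound of [plim_mass] would make that series converge. *)
Lemma plim_null y : (0 < d)%N -> mu <= lambda -> plim p (origin d) y = 0.
Proof.
move=> d0 ml; set f := plim p ^~ y; rewrite -[LHS]/(f (origin d)).
have [j jd f1] := exists_increasing_branch (plim_harm y) d0.
apply/eqP; rewrite eq_le plim0 andbT leNgt; apply/negP => f0.
have a0 : 0 < alpha / lambda by rewrite divr_gt0.
apply: (@dvg_harmonic R); apply: nondecreasing_is_cvgn.
  apply/nondecreasing_seqP => n; rewrite /series /= big_nat_recr//= lerDl.
  by rewrite /harmonic invr_ge0.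
exists (m y / (alpha / lambda * f (origin d))) => _ [n _ <-].
rewrite ler_pdivlMr; last exact: mulr_gt0.
apply: le_trans (plim_mass tf measure_gt0 star_rev y (ball_uniq n)).
rewrite sum_measure_ball -[leLHS]add0r; apply: lerD; first exact: plim0.
rewrite /series /= mulr_suml.
apply: ler_sum => k _; rewrite mulrA; apply: ler_pM.
- by rewrite mulr_ge0 ?ltW// /harmonic invr_ge0.
- exact: ltW.
- by rewrite mulrC; exact: weight_ge.
rewrite (bigD1_seq j) ?iota_uniq ?mem_iota1//=.
apply: le_trans (harmonic_ge_origin (plim_harm y) k.+1 jd f1) _.
by rewrite lerDl sumr_ge0.
Qed.

(** When [lambda < mu], [u^-1] is the sum of all [weight k], and [M] is the total mass of the star:
    the origin once and the positive levels [d] times. *)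
Local Notation u := ((1 - lambda / mu) `^ (alpha / lambda)).
Local Notation M := (1 + d%:R * (u^-1 - 1)).

Lemma mass_ball n :
  \sum_(x <- ball n) m x = 1 + d%:R * (\sum_(0 <= k < n.+1) weight k - 1).
Proof.
have := sum_measure_ball (fun=> 1) n; under eq_bigr do rewrite mulr1.
move=> ->; congr (_ + _); rewrite big_nat_recl// weight0 addrAC subrr add0r.
rewrite mulr_sumr; apply: eq_bigr => k _.
by rewrite big_const_seq count_predT size_iota iter_addr_0 mulrC.
Qed.

Section positive_recurrent.
Context (lambda_lt_mu : lambda < mu).

Let r_gt0 : 0 < lambda / mu. Proof. by rewrite divr_gt0. Qed.

Let r_lt1 : lambda / mu < 1.
Proof. by rewrite ltr_pdivrMr// mul1r. Qed.

Let a_gt0 : 0 < alpha / lambda. Proof. by rewrite divr_gt0. Qed.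

Lemma mass_le s : uniq s -> \sum_(x <- s) m x <= M.
Proof.
move=> us; pose n := (\max_(x <- s) (val x).1)%N.
apply: (@le_trans _ _ (\sum_(x <- ball n) m x)).
  have sE : perm_eq s [seq x <- ball n | x \in s].
    apply: uniq_perm => //; first by rewrite filter_uniq// ball_uniq.
    move=> x; rewrite mem_filter; case xs : (x \in s) => //=; apply/esym/mem_ball.
    exact: (@leq_bigmax_seq _ s xpredT (fun z => (val z).1) x xs isT).
  rewrite (perm_big _ sE) big_filter big_mkcond; apply: ler_sum => x _.
  by case: ifP => // _; exact/ltW/measure_gt0.
rewrite mass_ball lerD2l ler_wpM2l// lerD2r.
exact: binomial_series_le.
Qed.

Lemma mass_ball_cvg : \sum_(x <- ball n) m x @[n --> \oo] --> M.
Proof.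
under eq_cvg do rewrite mass_ball.
apply: cvgD; first exact: cvg_cst.
apply: cvgM; first exact: cvg_cst.
by apply: cvgB; [exact: binomial_series_cvg|exact: cvg_cst].
Qed.

Lemma mass_gt0 : 0 < M.
Proof.
have := mass_le (ball_uniq 0); rewrite big_seq1 measure_origin.
exact: lt_le_trans.
Qed.

(** The value [c] at the origin is at least [M^-1] by [plim_diag_ge]. Since the limit does not
    depend on the starting point, [plim_mass] over growing balls gives [c * M <= 1]. Reversibility
    then yields every [y]. *)
Lemma plim_positive y : plim p (origin d) y = m y / M.
Proof.
have plim01 z x : 0 <= plim p x z <= 1.
  by rewrite plim0 (plim_le1 tf measure_gt0 star_rev).
have const x z : plim p x z = plim p (origin d) z.
  exact: (harmonic_bounded_constant (plim_harm z) x lambda_lt_mu (plim01 z)).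
set c := plim p (origin d) (origin d).
have c_ge : M^-1 <= c.
  have := plim_diag_ge tf measure_gt0 star_rev (origin d) mass_gt0 mass_le.
  by rewrite measure_origin mul1r.
have c_le : c * M <= 1.
  have H : c * (\sum_(x <- ball n) m x) @[n --> \oo] --> c * M.
    by apply: cvgM; [exact: cvg_cst|exact: mass_ball_cvg].
  rewrite -(cvg_lim _ H)//; apply: limr_le; first exact: (cvgP _ H).
  near=> n.
  have := plim_mass tf measure_gt0 star_rev (origin d) (ball_uniq n).
  rewrite measure_origin mulr_sumr; apply: le_trans.
  by apply: ler_sum => x _; rewrite (const x) mulrC.
have cE : c = M^-1.
  by apply/le_anti; rewrite c_ge andbT -[leRHS]mul1r ler_pdivlMr// mass_gt0.
have := plim_rev tf measure_gt0 star_rev (origin d) y.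
by rewrite measure_origin mul1r => ->; rewrite const -/c cE.
Unshelve. all: by end_near. Qed.

End positive_recurrent.
End limits.

End star.

(** * From conditional probabilities to the transition function *)

Section probabilities.
Context (R : realType) (disp : measure_display) (T : measurableType disp).
Context (P : probability T R) (d : nat) (rate : state d -> state d -> R).
Context (X : R -> T -> state d).
Context (X_init : P [set w | X 0 w = origin d] = 1%E).
Context (p : R -> state d -> state d -> R).
Context (Xp : forall (s t : R) (h : seq (R * state d)) (x y : state d),
  0 <= s -> 0 <= t -> (forall e, e \in h -> 0 <= e.1 <= s) ->
  let past := [set w | X s w = x] `&` followed X h in
  (0 < P past)%E -> cprob P [set w | X (s + t) w = y] past = p t x y).

(** The Markov property at time 0 with an empty history, which imposes no condition. *)
Lemma cprob_transition t y : 0 <= t ->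
  cprob P [set w | X t w = y] [set w | X 0 w = origin d] = p t (origin d) y.
Proof.
move=> t0; have := @Xp 0 t [::] (origin d) y (lexx 0) t0.
have -> : followed X [::] = setT by apply/seteqP; split.
have P_gt0 : (0 < P [set w | X 0 w = origin d])%E by rewrite X_init lte01.
by rewrite setIT add0r; apply.
Qed.

Lemma p0E t : 0 <= t -> p0 P X t = p t (origin d) (origin d).
Proof. exact: cprob_transition. Qed.

Lemma PkE k t : (0 < k)%N -> 0 <= t ->
  Pk P X k t = \sum_(1 <= j < d.+1) p t (origin d) (st d k j).
Proof.
case: k => // k _ t0; rewrite /Pk big_nat_cond [RHS]big_nat_cond.
apply: eq_bigr => j; rewrite andbT ltnS => jd.
rewrite -cprob_transition// /pkj; congr cprob.
apply/seteqP; split => w /= => [Xw|->]; last exact: val_stS.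
by apply: val_inj; apply: (etrans Xw); rewrite val_stS.
Qed.

Context (tf : transition_function rate p) (m : state d -> R).
Context (m_gt0 : forall x, 0 < m x).
Context (rev : forall t x y, 0 <= t -> m x * p t x y = m y * p t y x).

Lemma p0_cvg : p0 P X t @[t --> +oo] --> plim p (origin d) (origin d).
Proof.
have E : {near +oo, (fun t => p t (origin d) (origin d)) =1 p0 P X}.
  by near=> t; rewrite p0E//; near: t; exact: nbhs_pinfty_ge.
have H : p t (origin d) (origin d) @[t --> +oo] --> plim p (origin d) (origin d).
  exact: (plim_cvg tf m_gt0 rev).
exact: cvg_trans (near_eq_cvg E) H.
Unshelve. all: by end_near. Qed.

Lemma Pk_cvg k : (0 < k)%N ->
  Pk P X k t @[t --> +oo] --> \sum_(1 <= j < d.+1) plim p (origin d) (st d k j).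
Proof.
move=> k0; have H : \sum_(1 <= j < d.+1) p t (origin d) (st d k j) @[t --> +oo]
    --> \sum_(1 <= j < d.+1) plim p (origin d) (st d k j).
  apply: cvg_big => [|j _]; first exact: add_continuous.
  exact: (plim_cvg tf m_gt0 rev).
have E : {near +oo, (fun t => \sum_(1 <= j < d.+1) p t (origin d) (st d k j))
    =1 Pk P X k}.
  by near=> t; rewrite PkE//; near: t; exact: nbhs_pinfty_ge.
exact: cvg_trans (near_eq_cvg E) H.
Unshelve. all: by end_near. Qed.

End probabilities.

(** * The limit law in both regimes *)

Theorem proposition5p1 (R : realType) (disp : measure_display)
    (T : measurableType disp) (P : probability T R)
    (d : nat) (alpha lambda mu : R) (X : R -> T -> state d)
    (d_gt0 : (0 < d)%N)
    (alpha_gt0 : 0 < alpha) (lambda_gt0 : 0 < lambda) (mu_gt0 : 0 < mu)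
    (X_ctmc : ctmc P (star_rate alpha lambda mu (d := d)) X)
    (X_init : P [set w | X 0 w = origin d] = 1%E) :
  (lambda < mu ->
    let u := (1 - lambda / mu) `^ (alpha / lambda) in
    p0 P X t @[t --> +oo] -->
      d%:R^-1 * (u / (1 - (1 - d%:R^-1) * u)) /\
    forall k : nat, (0 < k)%N ->
      Pk P X k t @[t --> +oo] -->
        u / (1 - (1 - d%:R^-1) * u) *
        (pochhammer (alpha / lambda) k / k`!%:R) * (lambda / mu) ^+ k) /\
  (mu <= lambda ->
    p0 P X t @[t --> +oo] --> (0 : R) /\
    forall k : nat, (0 < k)%N -> Pk P X k t @[t --> +oo] --> (0 : R)).
Proof.
case: X_ctmc => _ [p tf Xp].
have rev := star_rev alpha_gt0 lambda_gt0 mu_gt0 tf.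
have m_gt0 := measure_gt0 (d := d) alpha_gt0 lambda_gt0 mu_gt0.
have c0 := p0_cvg X_init Xp tf m_gt0 rev.
have ck := Pk_cvg X_init Xp tf m_gt0 rev.
split => [lm u|ml].
  have pE := plim_positive alpha_gt0 lambda_gt0 mu_gt0 tf lm.
  rewrite -/u in pE.
  have u_gt0 : 0 < u by rewrite powR_gt0// subr_gt0 ltr_pdivrMr// mul1r.
  have := mass_gt0 d alpha_gt0 lambda_gt0 mu_gt0 lm; rewrite -/u.
  set M := 1 + _ => M_gt0.
  have d0 : d%:R != 0 :> R by rewrite pnatr_eq0 -lt0n.
  (* The common factor of both formulas is [d / M]: the origin has limit [1 / M], and level [k]
     collects [d] states of limit [weight k / M] each. *)
  have uE : u / (1 - (1 - d%:R^-1) * u) = d%:R / M.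
    have -> : 1 - (1 - d%:R^-1) * u = u * M / d%:R.
      by rewrite /M; field; rewrite d0 gt_eqF.
    by move: (lt0r_neq0 M_gt0) (lt0r_neq0 u_gt0) => *; field; apply/and3P.
  split.
    have -> : d%:R^-1 * (u / (1 - (1 - d%:R^-1) * u)) =
        plim p (origin d) (origin d); last exact: c0.
    by rewrite pE measure_origin uE mulrA mulVf.
  move=> k k0.
  have -> : u / (1 - (1 - d%:R^-1) * u) *
      (pochhammer (alpha / lambda) k / k`!%:R) * (lambda / mu) ^+ k =
      \sum_(1 <= j < d.+1) plim p (origin d) (st d k j); last exact: ck.
  rewrite big_nat_cond (eq_bigr (fun=> weight alpha lambda mu k /
    M)); last first.
    by move=> j /andP[jd _]; rewrite pE measure_st.
  rewrite -big_nat_cond big_const_nat subSS subn0 iter_addr_0 uE.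
  by rewrite -[RHS]mulr_natl -[LHS]mulrA [LHS]mulrAC [RHS]mulrA.
split=> [|k k0].
  have <- := plim_null alpha_gt0 lambda_gt0 mu_gt0 tf (origin d) d_gt0 ml.
  exact: c0.
have -> : 0 = \sum_(1 <= j < d.+1) plim p (origin d) (st d k j); last exact: ck.
by rewrite big1// => j _; exact: (plim_null alpha_gt0 lambda_gt0 mu_gt0 tf _ d_gt0 ml).
Qed.
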